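(* Let $k\in[2.5,3)$ be rational and $\varepsilon$ a positive real with $\varepsilon<\frac{1}{k+\varepsilon}$. Then there exist a graph $G$ with fractional chromatic number $k$, a set $W\subseteq V(G)$ of vertices at pairwise distance at least six, and a fractional $(k+\varepsilon)$-precoloring of $W$ that cannot be extended to a fractional $(k+\varepsilon)$-coloring of $G$.
   Context: A fractional $m$-coloring of a graph (real $m>0$) assigns to each vertex a measurable subset of $[0,m)$ of Lebesgue measure one so that adjacent vertices receive disjoint sets; the fractional chromatic number is the infimum (for finite graphs the minimum) of $m$ for which a fractional $m$-coloring exists. A fractional $m$-precoloring of a vertex set $W$ assigns measurable subsets of $[0,m)$ of measure one to the vertices of $W$; it extends if some fractional $m$-coloring of the whole graph agrees with it on $W$. Graphs are finite. *)

(* Defs.v *)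
From Stdlib Require Import Reals ZArith.
Open Scope R_scope.

Definition is_glb (E : R -> Prop) (m : R) : Prop :=
  (forall x, E x -> m <= x) /\ (forall b, (forall x, E x -> b <= x) -> b <= m).

Definition cover_length (A : R -> Prop) (s : R) : Prop :=
  exists a b : nat -> R,
    (forall n, a n <= b n) /\
    (forall x, A x -> exists n, a n < x < b n) /\
    infinite_sum (fun n => b n - a n) s.

(* lebesgue_outer A v : the Lebesgue outer measure of A is finite and equals v *)
Definition lebesgue_outer (A : R -> Prop) (v : R) : Prop :=
  is_glb (cover_length A) v.

(* Caratheodory measurability (test sets of infinite outer measure satisfy the
   criterion automatically, so only finite ones are tested) *)
Definition lebesgue_measurable (A : R -> Prop) : Prop :=
  forall (E : R -> Prop) (v : R), lebesgue_outer E v ->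
    exists v1 v2, lebesgue_outer (fun x => E x /\ A x) v1 /\
                  lebesgue_outer (fun x => E x /\ ~ A x) v2 /\ v = v1 + v2.

Definition unit_subset (m : R) (S : R -> Prop) : Prop :=
  (forall x, S x -> 0 <= x < m) /\ lebesgue_measurable S /\ lebesgue_outer S 1.

Record graph := Graph {
  nverts : nat;
  adj : nat -> nat -> Prop;
  adj_sym : forall u v, adj u v -> adj v u;
  adj_irrefl : forall v, ~ adj v v;
  adj_range : forall u v, adj u v -> (u < nverts)%nat /\ (v < nverts)%nat
}.

Definition frac_coloring (G : graph) (m : R) (c : nat -> R -> Prop) : Prop :=
  (forall v, (v < nverts G)%nat -> unit_subset m (c v)) /\
  (forall u v, adj G u v -> forall x, ~ (c u x /\ c v x)).

Definition frac_colorable (G : graph) (m : R) : Prop :=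
  exists c, frac_coloring G m c.

Definition frac_chromatic_number (G : graph) (k : R) : Prop :=
  is_glb (fun m => 0 < m /\ frac_colorable G m) k.

Inductive walk (G : graph) : nat -> nat -> nat -> Prop :=
| walk_nil : forall v, walk G v v 0
| walk_cons : forall u w v l, adj G u w -> walk G w v l -> walk G u v (S l).

Definition dist_ge (G : graph) (u v d : nat) : Prop :=
  forall l, walk G u v l -> (d <= l)%nat.

Definition frac_precoloring (G : graph) (W : nat -> Prop) (m : R)
  (p : nat -> R -> Prop) : Prop :=
  forall v, W v -> unit_subset m (p v).

Definition precoloring_extends (G : graph) (W : nat -> Prop) (m : R)
  (p : nat -> R -> Prop) : Prop :=
  exists c, frac_coloring G m c /\ (forall v, W v -> forall x, c v x <-> p v x).

Definition is_rational (x : R) : Prop :=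
  exists (a : Z) (b : Z), b <> 0%Z /\ x = IZR a / IZR b.

(* Main.v *)
(** Write [k = a / b] with [b = 2 h] and put [d = a - 2 b], [t = a - b],
    [m = k + eps].  The core is the Kneser graph of the [b]-subsets of [Z/a],
    listed with repetition as the images [col s] of [{0, ..., b-1}] under the
    permutations [s].  Over each core vertex and each of [p] precolors hangs a
    gadget.  The precolors are cyclic windows of length one that cover every
    point of [[0, m)] at least [q] times, where [q / p > eps]; they exist
    because [eps < 1 / m].

    In the gadget over [S = col s], with the complement of [S] ordered
    cyclically by [s], weigh the vertex [S] at distance 2 from the root by
    [(b - d) t], the arcs [A_j] of length [b] of the complement, at distance 1,
    by [b], and by [d] the [t] adjacent pairs [B_j], [B'_j] at distance 2, made
    of one half of [S] and an arc of length [h] on either side of the [j]-th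
    point of the complement.  The total is [a t].  The vertices containing a
    fixed color [x] are independent, and an isoperimetric inequality on the
    cycle bounds their weight in one gadget by [b t].  If [x] belongs to the
    precolor, then no [A_j] contains [x], and the same inequality, for the
    rotation acting on permutations, shows that on average over [s] the weight
    drops by [b t] times the density of [x] in the core.  Integrating over [x]
    gives [p a + q b <= p b m], that is [q / p <= eps], a contradiction.  The
    hypothesis [5/2 <= k] is [h <= d]. *)

Require Import Defs.
From Stdlib Require Import Reals ZArith Lra Lia Classical ClassicalEpsilon List.
From mathcomp Require all_boot all_fingroup zify.
Open Scope R_scope.

(** * Lebesgue outer measure *)

(** Bounding the partial sums instead of naming their limit leaves the infimum unchanged, and unions
    of covers then involve no convergence. *)
Definition cover_le (A : R -> Prop) (s : R) : Prop :=
  exists a b : nat -> R,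
    (forall n, a n <= b n) /\
    (forall x, A x -> exists n, a n < x < b n) /\
    (forall N, sum_f_R0 (fun n => b n - a n) N <= s).

Lemma sum_f_R0_mono (f : nat -> R) (n m : nat) :
  (forall i, 0 <= f i) -> (n <= m)%nat -> sum_f_R0 f n <= sum_f_R0 f m.
Proof.
  intros Hf H; induction H as [|m H IH]; [lra|].
  simpl. specialize (Hf (S m)). lra.
Qed.

Lemma cover_length_cover_le A s : cover_length A s -> cover_le A s.
Proof.
  intros (a & b & Hab & HA & Hs). exists a, b; repeat split; auto.
  intros N. apply Rnot_lt_le; intros Hlt.
  destruct (Hs (sum_f_R0 (fun n => b n - a n) N - s)) as [N0 HN0]; [lra|].
  specialize (HN0 (max N N0) ltac:(lia)). unfold Rdist in HN0.
  assert (Hm := sum_f_R0_mono (fun n => b n - a n) N (max N N0)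
    ltac:(intros i; specialize (Hab i); lra) ltac:(lia)).
  apply Rabs_def2 in HN0. lra.
Qed.

Lemma cover_le_cover_length A s :
  cover_le A s -> exists s', s' <= s /\ cover_length A s'.
Proof.
  intros (a & b & Hab & HA & Hs).
  set (f := fun n => b n - a n) in *.
  assert (Hf : forall i, 0 <= f i) by (intros i; specialize (Hab i); unfold f; lra).
  destruct (growing_cv (sum_f_R0 f)) as [l Hl].
  - intros n; simpl. specialize (Hf (S n)). lra.
  - exists s. intros y [n ->]. apply Hs.
  - exists l. split.
    + apply Rnot_lt_le; intros Hlt.
      destruct (Hl (l - s)) as [N HN]; [lra|].
      specialize (HN N (le_n N)). unfold Rdist in HN. apply Rabs_def2 in HN.
      specialize (Hs N). lra.
    + exists a, b; repeat split; auto.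
Qed.

Lemma cover_le_ge0 A s : cover_le A s -> 0 <= s.
Proof.
  intros (a & b & Hab & _ & Hs). specialize (Hs 0%nat); simpl in Hs.
  specialize (Hab 0%nat). lra.
Qed.

Lemma cover_le_mono (A B : R -> Prop) s :
  (forall x, A x -> B x) -> cover_le B s -> cover_le A s.
Proof.
  intros H (a & b & Hab & HB & Hs). exists a, b; repeat split; auto.
Qed.

Lemma cover_le_union A B s s' :
  cover_le A s -> cover_le B s' -> cover_le (fun x => A x \/ B x) (s + s').
Proof.
  intros (a & b & Hab & HA & Hs) (a' & b' & Hab' & HB & Hs').
  (* The covers are interleaved, one at even and one at odd indices; the partial sum up to
     [S (2 * N)] is then exactly the sum of the two partial sums up to [N]. *)
  set (mix := fun (u v : nat -> R) n =>
    if Nat.even n then u (Nat.div2 n) else v (Nat.div2 n)).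
  assert (Hev : forall u v n, mix u v (2 * n)%nat = u n).
  { intros u v n. unfold mix. rewrite Nat.even_even, Nat.div2_double. reflexivity. }
  assert (Hod : forall u v n, mix u v (S (2 * n)) = v n).
  { intros u v n. unfold mix.
    rewrite Nat.div2_succ_double.
    replace (S (2 * n)) with (2 * n + 1)%nat by lia.
    rewrite Nat.even_odd. reflexivity. }
  assert (Hn : forall n, mix a a' n <= mix b b' n).
  { intros n. unfold mix. destruct (Nat.even n); auto. }
  exists (mix a a'), (mix b b'); repeat split.
  - exact Hn.
  - intros x [Hx|Hx].
    + destruct (HA x Hx) as [n Hx']. exists (2 * n)%nat. rewrite !Hev. exact Hx'.
    + destruct (HB x Hx) as [n Hx']. exists (S (2 * n)). rewrite !Hod. exact Hx'.
  - assert (Hsum : forall N, sum_f_R0 (fun n => mix b b' n - mix a a' n) (S (2 * N)) =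
      sum_f_R0 (fun n => b n - a n) N + sum_f_R0 (fun n => b' n - a' n) N).
    { induction N as [|N IH].
      - reflexivity.
      - replace (S (2 * S N)) with (S (S (S (2 * N)))) by lia.
        rewrite tech5, tech5, IH.
        replace (S (S (S (2 * N)))) with (S (2 * S N)) by lia.
        replace (S (S (2 * N))) with (2 * S N)%nat by lia.
        rewrite !Hod, !Hev. simpl sum_f_R0. ring. }
    intros N.
    assert (H1 := sum_f_R0_mono (fun n => mix b b' n - mix a a' n) N (S (2 * N))
      ltac:(intros i; specialize (Hn i); lra) ltac:(lia)).
    specialize (Hsum N); specialize (Hs N); specialize (Hs' N). simpl in *. lra.
Qed.

Lemma outer_le A v s : lebesgue_outer A v -> cover_le A s -> v <= s.
Proof.
  intros [H _] Hs. destruct (cover_le_cover_length _ _ Hs) as (s' & Hle & Hs').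
  specialize (H s' Hs'). lra.
Qed.

Lemma outer_approx A v e :
  lebesgue_outer A v -> 0 < e -> exists s, s < v + e /\ cover_le A s.
Proof.
  intros [_ H] He. apply NNPP; intros Hn.
  assert (v + e <= v); [|lra]. apply H. intros x Hx.
  apply Rnot_lt_le; intros Hlt. apply Hn. exists x; split; auto.
  apply cover_length_cover_le; auto.
Qed.

Lemma outer_of_cover_le A v :
  (forall s, cover_le A s -> v <= s) ->
  (forall e, 0 < e -> exists s, s <= v + e /\ cover_le A s) -> lebesgue_outer A v.
Proof.
  intros H1 H2; split.
  - intros x Hx. apply H1, cover_length_cover_le, Hx.
  - intros b Hb. apply Rnot_lt_le; intros Hlt.
    destruct (H2 ((b - v) / 2)) as (s & Hs & Hc); [lra|].
    destruct (cover_le_cover_length _ _ Hc) as (s' & Hle & Hs').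
    specialize (Hb s' Hs'). lra.
Qed.

Lemma outer_exists A s : cover_le A s -> exists v, lebesgue_outer A v.
Proof.
  intros Hs.
  (* The infimum is obtained as the negative of a supremum. *)
  destruct (completeness (fun y => cover_le A (- y))) as [l [Hl1 Hl2]].
  - exists 0. intros y Hy. apply cover_le_ge0 in Hy. lra.
  - exists (- s). rewrite Ropp_involutive. exact Hs.
  - exists (- l). apply outer_of_cover_le.
    + intros s' Hs'. assert (- s' <= l); [|lra].
      apply Hl1. rewrite Ropp_involutive. exact Hs'.
    + intros e He. apply NNPP; intros Hn.
      assert (l <= l - e); [|lra]. apply Hl2. intros y Hy.
      apply Rnot_lt_le; intros Hlt. apply Hn. exists (- y); split; [lra|exact Hy].
Qed.

Lemma outer_unique A v w : lebesgue_outer A v -> lebesgue_outer A w -> v = w.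
Proof.
  intros [H1 H2] [H3 H4]. apply Rle_antisym; auto.
Qed.

Lemma outer_mono (A B : R -> Prop) v w :
  (forall x, A x -> B x) -> lebesgue_outer A v -> lebesgue_outer B w -> v <= w.
Proof.
  intros HAB HA HB. apply Rnot_lt_le; intros Hlt.
  destruct (outer_approx B w (v - w) HB) as (s & Hs & Hc); [lra|].
  assert (v <= s); [|lra]. eapply outer_le; eauto using cover_le_mono.
Qed.

Lemma outer_ext (A B : R -> Prop) v :
  (forall x, A x <-> B x) -> lebesgue_outer A v -> lebesgue_outer B v.
Proof.
  intros H HA. apply outer_of_cover_le.
  - intros s Hs. eapply outer_le; [exact HA|].
    eapply cover_le_mono; [|exact Hs]. intros x; apply H.
  - intros e He. destruct (outer_approx A v e HA He) as (s & Hs & Hc).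
    exists s; split; [lra|]. eapply cover_le_mono; [|exact Hc]. intros x; apply H.
Qed.

Lemma outer_ge0 A v : lebesgue_outer A v -> 0 <= v.
Proof.
  intros HA. destruct HA as [_ H]. apply H. intros x Hx.
  eapply cover_le_ge0, cover_length_cover_le, Hx.
Qed.

Lemma outer_subset_exists (A B : R -> Prop) w :
  (forall x, A x -> B x) -> lebesgue_outer B w -> exists v, lebesgue_outer A v.
Proof.
  intros H HB. destruct (outer_approx B w 1 HB) as (s & _ & Hs); [lra|].
  eapply outer_exists, cover_le_mono; eauto.
Qed.

Lemma outer_union_exists A B v w :
  lebesgue_outer A v -> lebesgue_outer B w ->
  exists u, u <= v + w /\ lebesgue_outer (fun x => A x \/ B x) u.
Proof.
  intros HA HB.
  destruct (outer_approx A v 1 HA) as (s & _ & Hs); [lra|].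
  destruct (outer_approx B w 1 HB) as (s' & _ & Hs'); [lra|].
  destruct (outer_exists _ _ (cover_le_union _ _ _ _ Hs Hs')) as [u Hu].
  exists u; split; auto. apply Rnot_lt_le; intros Hlt.
  destruct (outer_approx A v ((u - v - w) / 2) HA) as (t & Ht & Hc); [lra|].
  destruct (outer_approx B w ((u - v - w) / 2) HB) as (t' & Ht' & Hc'); [lra|].
  assert (H := outer_le _ _ _ Hu (cover_le_union _ _ _ _ Hc Hc')). lra.
Qed.

(** Subadditivity supplies the reverse inequality, and both pieces have finite outer measure because
    they lie in [E]. *)
Lemma measurable_of_le (A : R -> Prop) :
  (forall E v v1 v2, lebesgue_outer E v ->
     lebesgue_outer (fun x => E x /\ A x) v1 ->
     lebesgue_outer (fun x => E x /\ ~ A x) v2 -> v1 + v2 <= v) ->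
  lebesgue_measurable A.
Proof.
  intros H E v HE.
  destruct (outer_subset_exists (fun x => E x /\ A x) E v) as [v1 H1]; [tauto|auto|].
  destruct (outer_subset_exists (fun x => E x /\ ~ A x) E v) as [v2 H2]; [tauto|auto|].
  exists v1, v2; split; [exact H1|split; [exact H2|]].
  apply Rle_antisym; [|eapply H; eauto].
  destruct (outer_union_exists _ _ _ _ H1 H2) as (u & Hu & HU).
  apply Rle_trans with u; auto. eapply outer_mono; [|exact HE|exact HU].
  intros x Hx. simpl. destruct (classic (A x)); tauto.
Qed.

Lemma measurable_split (A E : R -> Prop) v v1 v2 :
  lebesgue_measurable A -> lebesgue_outer E v ->
  lebesgue_outer (fun x => E x /\ A x) v1 ->
  lebesgue_outer (fun x => E x /\ ~ A x) v2 -> v = v1 + v2.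
Proof.
  intros HA HE H1 H2. destruct (HA E v HE) as (w1 & w2 & K1 & K2 & ->).
  rewrite (outer_unique _ _ _ H1 K1), (outer_unique _ _ _ H2 K2). reflexivity.
Qed.

Lemma measurable_ext (A B : R -> Prop) :
  (forall x, A x <-> B x) -> lebesgue_measurable A -> lebesgue_measurable B.
Proof.
  intros H HA E v HE. destruct (HA E v HE) as (v1 & v2 & H1 & H2 & ->).
  exists v1, v2; split; [|split; [|reflexivity]].
  - eapply outer_ext; [|exact H1]. intros x; simpl; rewrite H; tauto.
  - eapply outer_ext; [|exact H2]. intros x; simpl; rewrite H; tauto.
Qed.

Lemma measurable_compl (A : R -> Prop) :
  lebesgue_measurable A -> lebesgue_measurable (fun x => ~ A x).
Proof.
  intros HA E v HE. destruct (HA E v HE) as (v1 & v2 & H1 & H2 & ->).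
  exists v2, v1; split; [exact H2|split; [|ring]].
  eapply outer_ext; [|exact H1]. intros x; simpl.
  destruct (classic (A x)); tauto.
Qed.

(** Cut [E] along [A], then the part inside [A] along [B]. The part of [E] outside the intersection
    is measured by cutting it along [A] again. *)
Lemma measurable_inter (A B : R -> Prop) :
  lebesgue_measurable A -> lebesgue_measurable B ->
  lebesgue_measurable (fun x => A x /\ B x).
Proof.
  intros HA HB. apply measurable_of_le. intros E v v1 v2 HE H1 H2.
  destruct (HA E v HE) as (w1 & w2 & K1 & K2 & ->).
  destruct (HB _ _ K1) as (u1 & u2 & L1 & L2 & ->).
  assert (v1 = u1) as ->.
  { eapply outer_unique; [exact H1|]. eapply outer_ext; [|exact L1].
    intros x; simpl; tauto. }
  assert (v2 = u2 + w2) as ->; [|lra].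
  eapply (measurable_split A); [exact HA|exact H2| |].
  - eapply outer_ext; [|exact L2]. intros x; simpl; tauto.
  - eapply outer_ext; [|exact K2]. intros x; simpl; tauto.
Qed.

Lemma measurable_union (A B : R -> Prop) :
  lebesgue_measurable A -> lebesgue_measurable B ->
  lebesgue_measurable (fun x => A x \/ B x).
Proof.
  intros HA HB.
  eapply measurable_ext; [|apply measurable_compl, measurable_inter;
    [apply measurable_compl, HA|apply measurable_compl, HB]].
  intros x; simpl. destruct (classic (A x)), (classic (B x)); tauto.
Qed.

(** The criterion for [A] is applied with the union as test set. *)
Lemma outer_disjoint_union (A B : R -> Prop) v w :
  lebesgue_measurable A -> lebesgue_outer A v -> lebesgue_outer B w ->
  (forall x, ~ (A x /\ B x)) -> lebesgue_outer (fun x => A x \/ B x) (v + w).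
Proof.
  intros HA Hv Hw Hd. destruct (outer_union_exists _ _ _ _ Hv Hw) as (u & _ & Hu).
  assert (u = v + w) as <-; auto.
  eapply (measurable_split A); [exact HA|exact Hu| |].
  - eapply outer_ext; [|exact Hv]. intros x; simpl; tauto.
  - eapply outer_ext; [|exact Hw]. intros x; specialize (Hd x); simpl; tauto.
Qed.

Lemma sum_f_R0_cons (f : nat -> R) (c : R) N :
  sum_f_R0 (fun n => match n with O => c | S n => f n end) (S N) = c + sum_f_R0 f N.
Proof.
  induction N as [|N IH]; [reflexivity|]. rewrite tech5, IH, tech5. ring.
Qed.

Lemma cover_le_add_interval (A B : R -> Prop) s a b :
  a <= b -> cover_le A s -> (forall x, B x -> A x \/ a < x < b) ->
  cover_le B (s + (b - a)).
Proof.
  intros Hab (u & v & Huv & HA & Hs) HB.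
  exists (fun n => match n with O => a | S n => u n end),
         (fun n => match n with O => b | S n => v n end); repeat split.
  - intros [|n]; auto.
  - intros x Hx. destruct (HB x Hx) as [H|H].
    + destruct (HA x H) as [n Hn]. exists (S n). exact Hn.
    + exists 0%nat. exact H.
  - intros N.
    assert (Hm := sum_f_R0_mono (fun n => match n with O => b - a | S n => v n - u n end)
      N (S N) ltac:(intros [|i]; [lra|specialize (Huv i); lra]) ltac:(lia)).
    rewrite (sum_f_R0_cons (fun n => v n - u n)) in Hm.
    specialize (Hs N).
    rewrite (sum_eq _ (fun n => match n with O => b - a | S n => v n - u n end));
      [lra|]. intros [|i] _; reflexivity.
Qed.

Lemma cover_le_empty (A : R -> Prop) : (forall x, ~ A x) -> cover_le A 0.
Proof.
  intros H. exists (fun _ => 0), (fun _ => 0); split; [|split].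
  - intros; lra.
  - intros x Hx; destruct (H x Hx).
  - intros N. induction N; simpl in *; lra.
Qed.

Lemma cover_le_interval a b : a <= b -> cover_le (fun x => a < x < b) (b - a).
Proof.
  intros H. replace (b - a) with (0 + (b - a)) by ring.
  apply (cover_le_add_interval (fun _ => False)); auto.
  apply cover_le_empty; tauto.
Qed.

(** * Intervals: measurability and length *)

(** Every interval of a nearly optimal cover of [E] is cut at [c]. The open right parts miss the
    point [c], which gets a short interval of its own. *)
Lemma measurable_lt c : lebesgue_measurable (fun x => x < c).
Proof.
  apply measurable_of_le. intros E v v1 v2 HE H1 H2.
  (* The excess is [8 * e]. If neither side has a cheap cover, the cut lengths exceed [v1 - e] and
     [v2 - 3 * e], while their total is below [v + e]: a contradiction. *)
  apply Rnot_lt_le; intros Hlt. set (e := (v1 + v2 - v) / 8).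
  assert (He : 0 < e) by (unfold e; lra).
  destruct (outer_approx E v e HE He) as (s & Hs & a & b & Hab & HEc & Hsum).
  set (fl := fun n => Rmin (b n) c - Rmin (a n) c).
  set (fr := fun n => Rmax (b n) c - Rmax (a n) c).
  assert (Hfl : forall n, 0 <= fl n /\ 0 <= fr n /\ fl n + fr n = b n - a n).
  { intros n; specialize (Hab n). unfold fl, fr, Rmin, Rmax.
    destruct (Rle_dec (b n) c), (Rle_dec (a n) c); lra. }
  destruct (classic (forall N, sum_f_R0 fl N <= v1 - e)) as [HL|HL].
  { assert (v1 <= v1 - e); [|lra]. apply (outer_le _ _ _ H1).
    exists (fun n => Rmin (a n) c), (fun n => Rmin (b n) c); repeat split.
    - intros n. destruct (Hfl n) as [Hn _]. unfold fl in Hn. lra.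
    - intros x [Hx Hc]. destruct (HEc x Hx) as [n [Hn1 Hn2]]. exists n.
      split; [eapply Rle_lt_trans; [apply Rmin_l|auto]|apply Rmin_glb_lt; auto].
    - exact HL. }
  destruct (classic (forall N, sum_f_R0 fr N <= v2 - 3 * e)) as [HR|HR].
  { assert (v2 <= (v2 - 3 * e) + ((c + e) - (c - e))); [|lra]. apply (outer_le _ _ _ H2).
    apply (cover_le_add_interval (fun x => E x /\ c < x)); [lra| |].
    - exists (fun n => Rmax (a n) c), (fun n => Rmax (b n) c); repeat split.
      + intros n. destruct (Hfl n) as (_ & Hn & _). unfold fr in Hn. lra.
      + intros x [Hx Hc]. destruct (HEc x Hx) as [n [Hn1 Hn2]]. exists n.
        split; [apply Rmax_lub_lt; auto|eapply Rlt_le_trans; [exact Hn2|apply Rmax_l]].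
      + exact HR.
    - intros x [Hx Hc]. destruct (Rlt_dec c x); [left; auto|right; lra]. }
  apply not_all_ex_not in HL. destruct HL as [N1 HN1].
  apply not_all_ex_not in HR. destruct HR as [N2 HN2].
  set (N := max N1 N2).
  assert (L1 := sum_f_R0_mono fl N1 N ltac:(intros i; apply Hfl) ltac:(lia)).
  assert (L2 := sum_f_R0_mono fr N2 N ltac:(intros i; apply Hfl) ltac:(lia)).
  specialize (Hsum N).
  rewrite (sum_eq _ (fun n => fl n + fr n)), sum_plus in Hsum
    by (intros i _; symmetry; apply Hfl).
  apply Rnot_le_lt in HN1, HN2. unfold e in *. lra.
Qed.

Lemma measurable_Ico a b : lebesgue_measurable (fun x => a <= x < b).
Proof.
  eapply measurable_ext; [|apply measurable_inter;
    [apply measurable_compl, (measurable_lt a)|apply (measurable_lt b)]].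
  intros x; simpl. split; intros; lra.
Qed.

(* [sum_f_R0 (g x) N] is the length that the first [N + 1] intervals cut out of
   [[al, x]]; the set of [x] for which it is at least [x - al] for some [N]
   reaches [be]. *)
Lemma cover_le_Icc_ge al be s :
  al <= be -> cover_le (fun x => al <= x <= be) s -> be - al <= s.
Proof.
  intros Hle (a & b & Hab & HA & Hs).
  set (g := fun x n => Rmax (Rmin (b n) x) al - Rmax (Rmin (a n) x) al).
  assert (Hg : forall x n, 0 <= g x n <= b n - a n).
  { intros x n; specialize (Hab n). unfold g, Rmin, Rmax.
    repeat destruct Rle_dec; lra. }
  assert (Hgm : forall x y n, x <= y -> g x n <= g y n).
  { intros x y n Hxy; specialize (Hab n). unfold g, Rmin, Rmax.
    repeat destruct Rle_dec; lra. }
  set (T := fun x => al <= x <= be /\ exists N, x - al <= sum_f_R0 (g x) N).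
  destruct (completeness T) as [z [Hz1 Hz2]].
  { exists be. intros x [Hx _]; lra. }
  { exists al. split; [lra|]. exists 0%nat. simpl. specialize (Hg al 0%nat). lra. }
  assert (Haz : al <= z).
  { apply Hz1. split; [lra|]. exists 0%nat. simpl. specialize (Hg al 0%nat). lra. }
  assert (Hzb : z <= be) by (apply Hz2; intros x [Hx _]; lra).
  destruct (HA z (conj Haz Hzb)) as [n [Hn1 Hn2]].
  (* The interval around the supremum [z] contains a point [y] of [T], and carries membership in [T]
     from [y] past [z], as far as its right end or [be]. *)
  assert (Hy : exists y, T y /\ a n < y).
  { apply NNPP; intros Hno. assert (z <= a n); [|lra]. apply Hz2. intros x Hx.
    apply Rnot_lt_le; intros Hlt. apply Hno. exists x; auto. }
  destruct Hy as (y & [Hy [N HN]] & Hay).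
  assert (Hyz : y <= z) by (apply Hz1; split; eauto).
  assert (Hstep : forall w, y <= w < b n -> w <= be -> T w).
  { intros w Hw Hwb. split; [lra|]. exists (N + S n)%nat.
    assert (Hd : sum_f_R0 (fun i => g w i - g y i) n >= w - y).
    { apply Rle_ge. apply Rle_trans with (g w n - g y n).
      - unfold g, Rmin, Rmax. repeat destruct Rle_dec; lra.
      - destruct n as [|n]; [simpl; lra|]. rewrite tech5.
        assert (0 <= sum_f_R0 (fun i => g w i - g y i) n); [|lra].
        apply cond_pos_sum. intros i. specialize (Hgm y w i). lra. }
    assert (L1 := sum_f_R0_mono (g y) N (N + S n) ltac:(intros i; apply Hg) ltac:(lia)).
    assert (L2 := sum_f_R0_mono (fun i => g w i - g y i) n (N + S n)
      ltac:(intros i; specialize (Hgm y w i); lra) ltac:(lia)).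
    rewrite (minus_sum _ _ (N + S n)) in L2. lra. }
  assert (z = be) as ->.
  { apply Rle_antisym; auto. apply Rnot_lt_le; intros Hlt.
    set (w := Rmin be ((z + b n) / 2)).
    assert (z < w) by (unfold w; apply Rmin_glb_lt; lra).
    assert (w <= be) by apply Rmin_l.
    assert (w <= (z + b n) / 2) by apply Rmin_r.
    assert (w <= z); [|lra]. apply Hz1, Hstep; lra. }
  destruct (Hstep be) as [_ [N' HN']]; [lra|lra|].
  assert (L : sum_f_R0 (g be) N' <= sum_f_R0 (fun n => b n - a n) N').
  { apply sum_Rle. intros i _. apply Hg. }
  specialize (Hs N'). lra.
Qed.

Lemma outer_Ico a b : a <= b -> lebesgue_outer (fun x => a <= x < b) (b - a).
Proof.
  intros Hab. apply outer_of_cover_le.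
  - intros s Hs. apply Rnot_lt_le; intros Hlt.
    (* The covering bound applies to the compact interval from [a] to [b - e]; [e] keeps it nonempty
       and is small enough to contradict [s < b - a]. *)
    set (e := Rmin (b - a) ((b - a - s) / 2)).
    assert (He1 : e <= b - a) by apply Rmin_l.
    assert (He2 : e <= (b - a - s) / 2) by apply Rmin_r.
    assert (Hs0 := cover_le_ge0 _ _ Hs).
    assert (He : 0 < e) by (apply Rmin_glb_lt; lra).
    assert (H := cover_le_Icc_ge a (b - e) s ltac:(lra)).
    assert (b - e - a <= s); [apply H|lra].
    eapply cover_le_mono; [|exact Hs]. intros x; simpl; lra.
  - intros e He. exists (b - (a - e)); split; [lra|].
    eapply cover_le_mono; [|apply (cover_le_interval (a - e) b); lra].
    intros x; simpl; lra.
Qed.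

Lemma outer_empty (A : R -> Prop) : (forall x, ~ A x) -> lebesgue_outer A 0.
Proof.
  intros H. apply outer_of_cover_le.
  - intros s Hs. eapply cover_le_ge0, Hs.
  - intros e He. exists 0; split; [lra|]. apply cover_le_empty, H.
Qed.

(** * Combinatorial colors as intervals *)

(** Color [i] becomes the [i]-th cell of length [h]. With [h = / INR b], a set of [b] colors has
    measure one and [a] colors fill the interval of length [a / b]. *)
Definition atoms (h : R) (s : list nat) (x : R) : Prop :=
  exists i, In i s /\ INR i * h <= x < (INR i + 1) * h.

Lemma atoms_disjoint h s1 s2 :
  0 < h -> (forall i, In i s1 -> In i s2 -> False) ->
  forall x, ~ (atoms h s1 x /\ atoms h s2 x).
Proof.
  intros Hh Hd x [(i & Hi & H1) (j & Hj & H2)].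
  assert (i = j) as ->; [|exact (Hd j Hi Hj)].
  destruct (Nat.lt_trichotomy i j) as [H|[H|H]]; auto; exfalso;
    apply (le_INR (S _)) in H; rewrite S_INR in H; nra.
Qed.

Lemma atoms_outer h s :
  0 < h -> NoDup s ->
  lebesgue_measurable (atoms h s) /\ lebesgue_outer (atoms h s) (INR (length s) * h).
Proof.
  intros Hh Hs. induction Hs as [|i s Hi Hs [IHm IHo]].
  - assert (H0 : lebesgue_outer (atoms h nil) 0).
    { apply outer_empty. intros x (i & [] & _). }
    split.
    + eapply measurable_ext; [|exact (measurable_Ico 1 0)].
      intros x; split; [lra|intros (i & [] & _)].
    + simpl. rewrite Rmult_0_l. exact H0.
  - assert (Hext : forall x, (INR i * h <= x < (INR i + 1) * h) \/ atoms h s x <->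
      atoms h (i :: s) x).
    { intros x; split.
      - intros [H|(j & Hj & H)]; [exists i|exists j]; simpl; tauto.
      - intros (j & [->|Hj] & H); [left; auto|right; exists j; auto]. }
    split.
    + eapply measurable_ext; [exact Hext|].
      apply measurable_union; [apply measurable_Ico|exact IHm].
    + eapply outer_ext; [exact Hext|].
      replace (INR (length (i :: s)) * h)
        with (((INR i + 1) * h - INR i * h) + INR (length s) * h)
        by (simpl length; rewrite S_INR; ring).
      apply outer_disjoint_union;
        [apply measurable_Ico|apply outer_Ico; nra|exact IHo|].
      intros x [Hx Hy].
      apply (atoms_disjoint h (i :: nil) s Hh) with x.
      * intros j [->|[]] Hj; auto.
      * split; auto. exists i; simpl; auto.
Qed.

Lemma atoms_unit_subset (a b : nat) (s : list nat) :
  (0 < b)%nat -> NoDup s -> length s = b -> (forall i, In i s -> (i < a)%nat) ->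
  unit_subset (INR a / INR b) (atoms (/ INR b) s).
Proof.
  intros Hb Hs Hl Ha. apply lt_0_INR in Hb.
  assert (Hi := Rinv_0_lt_compat _ Hb).
  destruct (atoms_outer (/ INR b) s Hi Hs) as [Hm Ho]. split; [|split; [exact Hm|]].
  - intros x (i & Hin & H). assert (H0 := pos_INR i). specialize (Ha i Hin).
    apply (le_INR (S _)) in Ha. rewrite S_INR in Ha. unfold Rdiv. nra.
  - rewrite Hl, Rinv_r in Ho by lra. exact Ho.
Qed.

(** * Cyclic windows and the choice of their number *)

(** An arc of length one starting at [s] on the circle of length [m]; the second part is the piece
    that wraps around, empty when [s + 1 <= m]. *)
Definition window (m s : R) (x : R) : Prop :=
  (s <= x < Rmin (s + 1) m) \/ (0 <= x < s + 1 - m).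

Lemma window_unit_subset m s : 1 <= m -> 0 <= s < m -> unit_subset m (window m s).
Proof.
  intros Hm Hs.
  assert (HA := measurable_Ico s (Rmin (s + 1) m)).
  assert (HB := measurable_Ico 0 (s + 1 - m)).
  split; [|split].
  - assert (Rmin (s + 1) m <= m) by apply Rmin_r. intros x [Hx|Hx]; lra.
  - apply measurable_union; auto.
  - destruct (Rle_dec (s + 1) m) as [H|H].
    + eapply outer_ext; [|replace 1 with (s + 1 - s) by ring; apply (outer_Ico s (s + 1)); lra].
      intros x; unfold window. rewrite Rmin_left by lra. split; intros; lra.
    + replace 1 with ((m - s) + ((s + 1 - m) - 0)) by ring.
      unfold window. rewrite Rmin_right in * by lra.
      apply outer_disjoint_union; auto; [apply outer_Ico; lra|apply outer_Ico; lra|].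
      intros x; lra.
Qed.

(** The [p] starting points are equally spaced on the circle. The [q] last ones met up to [x] are
    all within [q * m / p <= 1] of it, so their windows contain [x]. *)
Lemma window_covered (m x : R) (p q : nat) :
  0 < m -> (0 < p)%nat -> INR q * m <= INR p -> (q <= p)%nat -> 0 <= x < m ->
  exists f : nat -> nat,
    (forall i j, (i < q)%nat -> (j < q)%nat -> f i = f j -> i = j) /\
    (forall j, (j < q)%nat -> (f j < p)%nat /\ window m (INR (f j) * (m / INR p)) x).
Proof.
  intros Hm Hp Hq Hqp Hx. apply lt_0_INR in Hp as HpR.
  set (e := m / INR p). assert (He : 0 < e) by (apply Rdiv_lt_0_compat; auto).
  assert (Hpe : INR p * e = m) by (unfold e; field; lra).
  assert (Hqe : INR q * e <= 1).
  { unfold e. apply Rmult_le_reg_r with (INR p); auto.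
    replace (INR q * (m / INR p) * INR p) with (INR q * m) by (field; lra). lra. }
  destruct (archimed (x / e)) as [Hu1 Hu2].
  assert (Hxe : 0 <= x / e) by (apply Rmult_le_pos; [lra|apply Rlt_le, Rinv_0_lt_compat, He]).
  assert (Hup : (0 < up (x / e))%Z) by (apply lt_IZR; lra).
  (* [up] exceeds the integer part by one, so [u] is the index of the grid cell containing [x]. *)
  set (u := Z.to_nat (up (x / e) - 1)).
  assert (Hu : INR u = IZR (up (x / e)) - 1).
  { unfold u. rewrite INR_IZR_INZ, Z2Nat.id, minus_IZR by lia. reflexivity. }
  assert (Hxx : x = x / e * e) by (field; lra).
  assert (Hux : INR u * e <= x < (INR u + 1) * e).
  { rewrite Hu. split; [rewrite Hxx at 2|rewrite Hxx at 1]; nra. }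
  assert (Hup' : (u < p)%nat) by (apply INR_lt; nra).
  exists (fun j => if le_dec j u then (u - j)%nat else (u + p - j)%nat). split.
  - intros i j Hi Hj. destruct (le_dec i u), (le_dec j u); lia.
  - intros j Hj.
    assert (HjR : (INR j + 1) * e <= 1).
    { apply (le_INR (S _)) in Hj. rewrite S_INR in Hj. nra. }
    destruct (le_dec j u) as [Hju|Hju]; (split; [lia|]).
    + left. rewrite minus_INR by lia. assert (H0 := pos_INR j). split; [nra|].
      apply Rmin_glb_lt; nra.
    + right. rewrite minus_INR, plus_INR by lia. split; [lra|]. nra.
Qed.

(** Once [p * (1 / m - e) > 1], an integer [q] fits between [e * p] and [p / m]. *)
Lemma exists_ratio (e m : R) :
  0 < e -> 1 < m -> e < 1 / m ->
  exists p q : nat, (0 < p)%nat /\ (q <= p)%nat /\ INR q * m <= INR p /\ e * INR p < INR q.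
Proof.
  intros He Hm Hem.
  assert (Hd : 0 < 1 / m - e) by lra.
  destruct (archimed (1 / (1 / m - e))) as [Hp _].
  assert (H1 : 0 < 1 / (1 / m - e)) by (apply Rdiv_lt_0_compat; lra).
  set (P := up (1 / (1 / m - e))) in *.
  assert (HP : (0 < P)%Z) by (apply lt_IZR; lra).
  set (p := Z.to_nat P).
  assert (HpR : INR p = IZR P) by (unfold p; rewrite INR_IZR_INZ, Z2Nat.id; [auto|lia]).
  assert (Hpp : 1 < INR p * (1 / m - e)).
  { rewrite HpR. apply Rmult_lt_reg_r with (/ (1 / m - e)); [apply Rinv_0_lt_compat; lra|].
    rewrite Rmult_assoc, Rinv_r by lra. unfold Rdiv at 1 in Hp. lra. }
  destruct (archimed (e * INR p)) as [Hq1 Hq2].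
  assert (Hpos : 0 < INR p) by nra.
  assert (Hep : 0 < e * INR p) by (apply Rmult_lt_0_compat; auto).
  set (Q := up (e * INR p)) in *.
  assert (HQ : (0 < Q)%Z) by (apply lt_IZR; lra).
  set (q := Z.to_nat Q).
  assert (HqR : INR q = IZR Q) by (unfold q; rewrite INR_IZR_INZ, Z2Nat.id; [auto|lia]).
  assert (Hqm : INR q * m <= INR p).
  { assert (INR q <= INR p * (1 / m)) by (rewrite HqR; lra).
    replace (INR p) with (INR p * (1 / m) * m) by (field; lra).
    apply Rmult_le_compat_r; lra. }
  exists p, q; repeat split; auto.
  - apply INR_lt; simpl; lra.
  - apply INR_le. assert (H0 := pos_INR q). nra.
  - lra.
Qed.

(** * Integration of pointwise weight bounds *)

Definition indic (P : Prop) : nat := if excluded_middle_informative P then 1%nat else 0%nat.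

Fixpoint lsum {J : Type} (f : J -> nat) (s : list J) : nat :=
  match s with nil => 0%nat | j :: s => (f j + lsum f s)%nat end.

(* Splitting the test set [E] along each [X j] in turn reduces the integration
   of a simple function to Caratheodory's criterion, with no need for
   measurability of [E]. *)
Lemma lsum_measure_le {J : Type} (w : J -> nat) (X : J -> R -> Prop) (s : list J) :
  (forall j, In j s -> lebesgue_measurable (X j)) ->
  forall (E : R -> Prop) (e : R) (c K : nat) (y : J -> R),
  lebesgue_outer E e ->
  (forall j, In j s -> lebesgue_outer (fun x => E x /\ X j x) (y j)) ->
  (forall x, E x -> (c + lsum (fun j => w j * indic (X j x)) s <= K)%nat) ->
  INR c * e + fold_right (fun j r => INR (w j) * y j + r) 0 s <= INR K * e.
Proof.
  induction s as [|j s IH]; intros Hm E e c K y HE Hy Hb.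
  - simpl. rewrite Rplus_0_r.
    (* On an empty [E] the hypothesis says nothing about [c] and [K], but both sides vanish. *)
    destruct (classic (exists x, E x)) as [[x Hx]|Hn].
    + apply Rmult_le_compat_r; [eapply outer_ge0, HE|].
      apply le_INR. specialize (Hb x Hx). simpl in Hb. lia.
    + rewrite (outer_unique E e 0 HE); [lra|].
      apply outer_empty. intros x Hx; apply Hn; eauto.
  - assert (Hmj := Hm j (or_introl eq_refl)).
    set (E1 := fun x => E x /\ X j x). set (E2 := fun x => E x /\ ~ X j x).
    destruct (Hmj E e HE) as (e1 & e2 & H1 & H2 & ->).
    assert (Hex : forall (F : R -> Prop), (forall x, F x -> E x) ->
      exists z : J -> R, forall i, lebesgue_outer (fun x => F x /\ X i x) (z i)).
    { intros F HF.
      assert (Hi : forall i, exists z, lebesgue_outer (fun x => F x /\ X i x) z).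
      { intros i. eapply outer_subset_exists; [|exact HE]. intros x [Hx _]; auto. }
      exists (fun i => proj1_sig (constructive_indefinite_description _ (Hi i))).
      intros i. apply proj2_sig. }
    destruct (Hex E1) as [z1 Hz1]; [unfold E1; tauto|].
    destruct (Hex E2) as [z2 Hz2]; [unfold E2; tauto|].
    (* The constant [c] collects the weights of the sets already known to contain the current test
       set. *)
    assert (IH1 := IH (fun i Hi => Hm i (or_intror Hi)) E1 e1 (c + w j)%nat K z1 H1
      (fun i _ => Hz1 i)).
    assert (IH2 := IH (fun i Hi => Hm i (or_intror Hi)) E2 e2 c K z2 H2
      (fun i _ => Hz2 i)).
    assert (Hs : fold_right (fun j r => INR (w j) * y j + r) 0 s =
      fold_right (fun j r => INR (w j) * z1 j + r) 0 s +
      fold_right (fun j r => INR (w j) * z2 j + r) 0 s).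
    { assert (Hyz : forall i, In i s -> y i = z1 i + z2 i).
      { intros i Hi. eapply (measurable_split (X j)); [exact Hmj|apply Hy; right; auto| |].
        - eapply outer_ext; [|apply (Hz1 i)]. unfold E1; intros x; tauto.
        - eapply outer_ext; [|apply (Hz2 i)]. unfold E2; intros x; tauto. }
      clear - Hyz. induction s as [|i s IH]; simpl; [ring|].
      rewrite IH by (intros; apply Hyz; right; auto).
      rewrite Hyz by (left; auto). ring. }
    simpl fold_right. rewrite Hs.
    rewrite (outer_unique _ _ _ (Hy j (or_introl eq_refl)) H1).
    rewrite plus_INR in IH1.
    enough (INR (c + w j) * e1 + fold_right (fun j r => INR (w j) * z1 j + r) 0 s <= INR K * e1
      /\ INR c * e2 + fold_right (fun j r => INR (w j) * z2 j + r) 0 s <= INR K * e2)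
      by (rewrite plus_INR in *; nra).
    rewrite plus_INR. split; [apply IH1|apply IH2].
    + intros x [Hx Hj]. specialize (Hb x Hx). simpl in Hb. unfold indic in Hb at 1.
      destruct (excluded_middle_informative (X j x)); [lia|contradiction].
    + intros x [Hx Hj]. specialize (Hb x Hx). simpl in Hb. unfold indic in Hb at 1.
      destruct (excluded_middle_informative (X j x)); [contradiction|lia].
Qed.

(** Integration over [[0, m)]: each set has measure one and contributes exactly its weight. *)
Lemma unit_sets_weight_le {J : Type} (w : J -> nat) (X : J -> R -> Prop)
    (s : list J) (m : R) (K : nat) :
  0 <= m -> (forall j, unit_subset m (X j)) ->
  (forall x, 0 <= x < m -> (lsum (fun j => w j * indic (X j x)) s <= K)%nat) ->
  INR (lsum w s) <= INR K * m.
Proof.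
  intros Hm HX Hb.
  assert (H := lsum_measure_le w X s (fun j _ => proj1 (proj2 (HX j)))
    (fun x => 0 <= x < m) (m - 0) 0 K (fun _ => 1) (outer_Ico 0 m Hm)).
  replace (INR (lsum w s)) with
    (INR 0 * (m - 0) + fold_right (fun j r => INR (w j) * 1 + r) 0 s).
  - rewrite Rminus_0_r in *. apply H; [|exact Hb].
    intros j _. eapply outer_ext; [|apply (HX j)].
    intros x; split; [|tauto]. intros Hx; split; auto. apply (HX j); auto.
  - simpl. rewrite Rmult_0_l, Rplus_0_l. clear.
    induction s as [|j s IH]; [reflexivity|].
    simpl. rewrite plus_INR, IH. ring.
Qed.

Section GraphConstruction.

Import all_boot all_fingroup zify Rdefinitions.
Local Open Scope nat_scope.
Set Implicit Arguments.
Unset Strict Implicit.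
Unset Printing Implicit Defensive.

(** * Isoperimetry along an injection *)

Lemma card_preim_inj (T : finType) (f : T -> T) (X : {set T}) :
  injective f -> #|f @^-1: X| = #|X|.
Proof. by move=> f_inj; rewrite on_card_preimset //; apply/onW_bij/injF_bij. Qed.

Section Thickening.
Variables (T : finType) (f : T -> T).
Hypothesis f_inj : injective f.
Implicit Types (I X M : {set T}) (d h : nat).

Fixpoint thicken I d : {set T} :=
  if d is d'.+1 then thicken I d' :|: f @^-1: thicken I d' else I.

Lemma iter_thicken I d j x : j <= d -> iter j f x \in I -> x \in thicken I d.
Proof.
elim: d j x => [|d IHd] [|j] x //= le_jd; rewrite ?inE => Ix.
  by rewrite (IHd 0).
by rewrite (IHd j (f x)) ?orbT // -iterSr.
Qed.

Lemma thickenP I d x :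
  reflect (exists2 j, j <= d & iter j f x \in I) (x \in thicken I d).
Proof.
apply: (iffP idP) => [|[j]]; last exact: iter_thicken.
elim: d x => [|d IHd] x /=; first by exists 0.
rewrite !inE => /orP[/IHd[j le_jd Ij]|/IHd[j le_jd Ij]].
  by exists j => //; apply: leqW.
by exists j.+1 => //; rewrite iterSr.
Qed.

(** Since [f] permutes [T] in cycles, this counts the maximal arcs of [X], by the point just before
    each; cycles inside [X] are not counted. *)
Definition entries X := [set x | (x \notin X) && (f x \in X)].

(** A thickening step adds exactly the entries of the current set. Their number never grows, because
    [f] maps entries of the larger set to entries of the smaller one, so every step adds at least
    the final number. *)
Lemma thicken_card I d : #|I| + d * #|entries (thicken I d)| <= #|thicken I d|.
Proof.
elim: d => [|d IHd] /=; first by rewrite addn0.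
set X := thicken I d in IHd *; set Y := X :|: _.
have -> : #|Y| = #|X| + #|entries X|.
  rewrite -cardsUI; have -> : X :&: entries X = set0.
    by apply/setP=> x; rewrite !inE; case: (x \in X).
  rewrite cards0 addn0; congr #|pred_of_set _|.
  by apply/setP=> x; rewrite !inE; case: (x \in X).
have le_e : #|entries Y| <= #|entries X|.
  rewrite -(card_imset _ f_inj) subset_leq_card //.
  apply/subsetP=> _ /imsetP[x xE ->]; move: xE.
  by rewrite !inE; case: (f x \in X); rewrite ?orbT //=; case: (x \in X).
by rewrite mulSn addnA addnAC leq_add // (leq_trans _ IHd) // leq_add2l leq_mul2l le_e orbT.
Qed.

Lemma iter_inj h : injective (iter h f).
Proof. by elim: h => [|h IHh] x y //= /f_inj/IHh. Qed.

(** A path of [h] steps from outside [X] into [X] passes an entry at one of these steps, and [f] is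
    injective. *)
Lemma card_iter_entries X h :
  #|[set x | (x \notin X) && (iter h f x \in X)]| <= h * #|entries X|.
Proof.
elim: h => [|h IHh].
  by rewrite leqn0 cards_eq0; apply/eqP/setP=> x; rewrite !inE; case: (x \in X).
rewrite mulSnr (leq_trans _ (leq_add IHh (leqnn _))) //.
rewrite -(card_preim_inj (entries X) (@iter_inj h)) (leq_trans _ (leq_card_setU _ _)) //.
by apply/subset_leq_card/subsetP=> x; rewrite !inE /=; case: (iter h f x \in X); case: (x \in X).
Qed.

(** A selected vertex of a pair [B_j], [B'_j] forces one of these two conditions, so this set bounds
    the number of selected pairs. *)
Definition exits h X := [set x | (x \notin X) || (iter h f x \notin X)].

Lemma card_exits_le2 h X : #|exits h X| <= 2 * #|~: X|.
Proof.
have -> : exits h X = ~: X :|: iter h f @^-1: ~: X by apply/setP=> x; rewrite !inE.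
by rewrite mul2n -addnn -{2}(card_preim_inj (~: X) (@iter_inj h)) leq_card_setU.
Qed.

(** As [iter h f] preserves cardinality, as many points leave [X] after [h] steps as come into
    it. *)
Lemma card_exits_le h X : #|exits h X| <= #|~: X| + h * #|entries X|.
Proof.
have -> : exits h X = ~: X :|: X :\: (iter h f @^-1: X).
  by apply/setP=> x; rewrite !inE; case: (x \in X); rewrite ?andbT ?andbF ?orbF.
rewrite (leq_trans (leq_card_setU _ _)) // leq_add2l.
apply: leq_trans (card_iter_entries X h); rewrite leq_eqVlt; apply/orP; left.
have -> : [set x | (x \notin X) && (iter h f x \in X)] = (iter h f @^-1: X) :\: X.
  by apply/setP=> x; rewrite !inE.
rewrite -(eqn_add2l #|X :&: (iter h f @^-1: X)|) cardsID setIC cardsID.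
by rewrite (card_preim_inj _ (@iter_inj h)).
Qed.

Lemma card_set_setC X : #|X| + #|~: X| = #|T|.
Proof. by rewrite cardsC. Qed.

(* With [b = dl + d], tight when [f] is a rotation and [I] is an interval of
   length between [dl] and [b]. *)
Lemma exits_isoperimetry (I : {set T}) (dl d : nat) :
  dl * #|~: thicken I d| + d * #|exits (dl + d) (thicken I d)| + (dl + d) * #|I|
    <= (dl + d) * #|T|.
Proof.
have := thicken_card I d; have := card_exits_le (dl + d) (thicken I d).
rewrite -(card_set_setC (thicken I d)).
move: #|exits _ _| #|~: _| #|entries _| #|thicken I d| #|I| => u m q x i.
by move=> le_u le_i; nia.
Qed.

(** The two bounds on exits are mixed so that the entries they cost are exactly those paid for by
    thickening [d - h] times. *)
Lemma exits_isoperimetry_half (I : {set T}) (h d : nat) :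
  h <= d -> d <= 2 * h ->
  d * #|exits h (thicken I (d - h))| + 2 * h * #|I| <= 2 * h * #|T|.
Proof.
move=> le_hd le_d2h.
have := thicken_card I (d - h); have := card_exits_le h (thicken I (d - h)).
have := card_exits_le2 h (thicken I (d - h)).
rewrite -(card_set_setC (thicken I (d - h))).
have [dl def_dl] : {dl | 2 * h = d + dl} by exists (2 * h - d); lia.
have [e def_d] : {e | d = h + e} by exists (d - h); lia.
have -> : d - h = e by lia.
move: #|exits _ _| #|~: _| #|entries _| #|thicken _ _| #|I| => u m q x i.
move=> le_u2 le_u le_i.
(* The convex combination of the two bounds on [u] with weights [dl] and [e]. *)
have le_du : d * u <= dl * (2 * m) + 2 * e * (m + h * q).
  have -> : d = dl + 2 * e by lia.
  by rewrite mulnDl leq_add // leq_mul.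
have : 2 * h * (i + e * q) <= 2 * h * x by rewrite leq_mul.
have : dl * (2 * m) + 2 * e * m = 2 * h * m by rewrite mulnA -mulnDl; congr (_ * _); lia.
nia.
Qed.

Hypothesis f_cyclic : forall x y, exists j, iter j f x = y.

(** The image of [I] under [iter b f] avoids the thickening of [I] by [d], which has at least
    [#|I| + d] elements; so [2 * #|I| + d <= 2 * b + d]. *)
Lemma independent_card (I : {set T}) (b d : nat) :
  #|T| = 2 * b + d ->
  (forall x j, x \in I -> b <= j <= b + d -> iter j f x \notin I) -> #|I| <= b.
Proof.
move=> cardT indep; have [->|[x Ix]] := set_0Vmem I; first by rewrite cards0.
set X := thicken I d.
have IbX : iter b f @: I \subset ~: X.
  apply/subsetP=> _ /imsetP[y Iy ->]; rewrite inE; apply/negP=> /thickenP[j le_jd].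
  by rewrite -iterD; apply/negP/indep => //; rewrite addnC leq_addr leq_add2l.
have := subset_leq_card IbX; rewrite card_imset; last exact: iter_inj.
have := thicken_card I d; have := card_set_setC X; rewrite -/X cardT.
(* Without an entry the complement of [X] would be closed under [f], yet its orbit returns to
   [I]. *)
suff : 0 < #|entries X| by nia.
rewrite lt0n; apply/eqP=> /cards0_eq eX.
have closed_X y j : y \notin X -> iter j f y \notin X.
  move=> Xy; elim: j => //= j IHj; apply/negP=> Xj.
  by move/setP/(_ (iter j f y)): eX; rewrite !inE IHj Xj.
have /closed_X Xb : iter b f x \notin X.
  by move/subsetP/(_ _ (imset_f _ Ix)): IbX; rewrite inE.
have [j def_x] := f_cyclic (iter b f x) x.
by have := Xb j; rewrite def_x (@iter_thicken I d 0).
Qed.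

End Thickening.

Lemma sum_bool_card (T : finType) (P : pred T) : \sum_x (P x : nat) = #|[set x | P x]|.
Proof.
by rewrite -sum1_card [RHS]big_mkcond; apply: eq_bigr => x _; rewrite inE; case: (P x).
Qed.

Lemma sum_bool_le_inj (T : finType) (g : T -> T) (P : pred T) (Y : {set T}) :
  injective g -> (forall x, P x -> g x \in Y) -> \sum_x (P x : nat) <= #|Y|.
Proof.
move=> g_inj PY; rewrite sum_bool_card -(card_imset _ g_inj).
by apply/subset_leq_card/subsetP=> _ /imsetP[x + ->]; rewrite inE => /PY.
Qed.

(** * The graph *)

Section Gadget.
Variables (h d p : nat).
Hypotheses (h_gt0 : 0 < h) (le_hd : h <= d) (le_d2h : d <= 2 * h).
Local Notation b := (2 * h).
Local Notation a := (2 * b + d).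
Local Notation t := (b + d).
Local Open Scope group_scope.

Definition shift : 'S_a := perm (@ordS_inj a).

Lemma shiftE j (i : 'I_a) : (shift ^+ j) i = (i + j) %% a :> nat.
Proof.
rewrite permX; elim: j => [|j IHj]; first by rewrite /= addn0 modn_small.
by rewrite iterS permE /= IHj -addn1 modnDml addn1 addnS.
Qed.

(** The first [b] points are fixed and the other [t] rotated; the value lies below [a], so the
    default of [insubd] is never taken. *)
Definition turn_fun (i : 'I_a) : 'I_a :=
  insubd i (if i < b then i : nat else b + (i - b).+1 %% t).

Lemma turn_funE (i : 'I_a) :
  turn_fun i = (if i < b then i : nat else b + (i - b).+1 %% t) :> nat.
Proof.
rewrite val_insubd; case: (ltnP i b) => [ib|ib]; first by rewrite ltn_ord.
have := ltn_pmod (i - b).+1 (_ : 0 < t).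
by case: ifP => // /negbT; lia.
Qed.

Lemma turn_fun_inj : injective turn_fun.
Proof.
move=> i i' /(congr1 val); rewrite /= !turn_funE => eq_ii; apply/val_inj => /=.
have t_gt0 : 0 < t by lia.
move: eq_ii; case: (ltnP i b) => ib; case: (ltnP i' b) => ib'; try lia.
move/eqP; rewrite eqn_add2l -[(i - _).+1]addn1 -[(i' - _).+1]addn1 eqn_modDr !modn_small;
  have := ltn_ord i; have := ltn_ord i'; lia.
Qed.

Definition turn : 'S_a := perm turn_fun_inj.

Lemma turnE j (i : 'I_a) :
  (turn ^+ j) i = (if i < b then i : nat else b + (i - b + j) %% t) :> nat.
Proof.
rewrite permX; elim: j => [|j IHj].
  rewrite /=; case: ltnP => // le_bi; rewrite addn0 modn_small; have := ltn_ord i; lia.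
rewrite iterS permE turn_funE IHj; case: (ltnP i b) => [->|le_bi] //.
rewrite ltnNge leq_addr /= addKn; congr (b + _).
by rewrite -addn1 modnDml addn1 addnS.
Qed.

Lemma shift_full : shift ^+ a = 1.
Proof.
by apply/permP=> i; apply/val_inj; rewrite /= shiftE modnDr modn_small // perm1.
Qed.

Lemma turn_mod j : turn ^+ (j %% t) = turn ^+ j.
Proof.
by apply/permP=> i; apply/val_inj; rewrite /= !turnE modnDmr.
Qed.

Definition col (s : 'S_a) : {set 'I_a} := s @: [set i : 'I_a | i < b].

Lemma card_col s : #|col s| = b.
Proof.
rewrite card_imset; last exact: perm_inj.
have le_ba : b <= a by lia.
rewrite -sum1_card (eq_bigl (fun i : 'I_a => i < b)) => [|i]; last by rewrite inE.
by rewrite (big_ord_narrow le_ba) sum1_card card_ord.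
Qed.

Lemma disjoint_col (s u v : 'S_a) :
  (forall i i' : 'I_a, i < b -> i' < b -> u i <> v i' :> nat) ->
  [disjoint col (u * s) & col (v * s)].
Proof.
move=> neq_uv; apply/pred0P=> x /=; apply/negP=> /andP[/imsetP[i + ->] /imsetP[i' +]].
rewrite !inE !permM => ib i'b /perm_inj eq_uv.
by apply: (neq_uv i i' ib i'b); rewrite eq_uv.
Qed.

Lemma disjoint_col_shift (s : 'S_a) j :
  b <= j <= b + d -> [disjoint col s & col (shift ^+ j * s)].
Proof.
move=> j_int; rewrite -{1}[s]mul1g; apply: disjoint_col => i i' ib i'b.
rewrite perm1 shiftE.
case: (ltnP (i' + j) a) => [lt_a|le_a]; first by rewrite modn_small //; lia.
by rewrite -(subnK le_a) modnDr modn_small; lia.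
Qed.

(* The arcs [A_j], [B_j] and [B'_j] as initial segments of permutations: [turn]
   rotates the complement of [col s], [shift] moves the initial segment. *)
Definition posA j (s : 'S_a) := shift ^+ b * (turn ^+ j * s).
Definition posB j (s : 'S_a) := shift ^+ (a - h) * (turn ^+ j * s).
Definition posB' j (s : 'S_a) := shift ^+ h * (turn ^+ j * s).

Lemma shift_posA (i : 'I_a) j : i < b ->
  (turn ^+ j) ((shift ^+ b) i) = b + (i + j) %% t :> nat.
Proof.
move=> ib; rewrite turnE shiftE modn_small; last by lia.
by rewrite ltnNge leq_addl /= addnK.
Qed.

Lemma disjoint_posA j s : [disjoint col s & col (posA j s)].
Proof.
rewrite /posA mulgA -{1}[s]mul1g; apply: disjoint_col => i i' ib i'b.
by rewrite perm1 permM shift_posA //; lia.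
Qed.

(** Number the complement from its [j]-th point. [posB j] takes the last [h] of [t] places and
    [posA (j + r)] the places [r] to [r + b - 1], which stay below [t - h]. *)
Lemma disjoint_posA_posB j r s :
  r <= d - h -> [disjoint col (posA (j + r) s) & col (posB j s)].
Proof.
move=> le_r; rewrite /posA /posB (addnC j r) (expgnDr turn) -mulgA (mulgA (shift ^+ b)).
apply: disjoint_col => i i' ib i'b.
rewrite permM shift_posA // shiftE modn_small; last by lia.
case: (ltnP (i' + (a - h)) a) => [lt_a|le_a]; first by rewrite modn_small //; lia.
by rewrite -(subnK le_a) modnDr modn_small; lia.
Qed.

(** In the same numbering [posB' j] takes the first [h] places, and the arc from [r] fits between
    place [h] and the end. *)
Lemma disjoint_posA_posB' j r s :
  h <= r <= d -> [disjoint col (posA (j + r) s) & col (posB' j s)].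
Proof.
move=> int_r; rewrite /posA /posB' (addnC j r) (expgnDr turn) -mulgA (mulgA (shift ^+ b)).
apply: disjoint_col => i i' ib i'b.
rewrite permM shift_posA // shiftE !modn_small; lia.
Qed.

(** The members of a pair are [b] shifts apart: this makes them adjacent and lets [exits] along
    [mulg shift] treat both at once. *)
Lemma posB'E j s : posB' j s = shift ^+ b * posB j s.
Proof.
rewrite /posB /posB' (mulgA (shift ^+ b)) -(expgnDr shift); have -> : b + (a - h) = h + a by lia.
by rewrite (expgnDr shift) shift_full mulg1.
Qed.

Lemma iter_mulg_shift j s : iter j (mulg shift) s = shift ^+ j * s.
Proof. by elim: j => [|j /= ->]; rewrite ?mul1g // expgS mulgA. Qed.

Lemma iter_ordS n j (i : 'I_n) : iter j (@ordS n) i = (i + j) %% n :> nat.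
Proof.
elim: j => [|j IHj]; first by rewrite addn0 modn_small.
by rewrite iterS /= IHj -addn1 modnDml addn1 addnS.
Qed.


Lemma iter_ordS_full (i j : 'I_a) : exists k, iter k (@ordS a) i = j.
Proof.
exists (j + a - i); apply/val_inj; rewrite /= iter_ordS.
by rewrite subnKC ?modnDr ?modn_small // ltnW // ltn_addl.
Qed.

Local Close Scope group_scope.

Local Notation gadget := ('S_a * 'I_p)%type.

(* The same vertex of the Kneser graph is listed once for each permutation with
   the same [col].  [core s], [root g], [inner g s] and [outer g s] are at distance at least
   3, 0, 1 and 2 from the precolored vertex [root g] of their gadget. *)
Definition vertex : finType := ('S_a + gadget * option (bool * 'S_a))%type.

Definition core (s : 'S_a) : vertex := inl s.
Definition root (g : gadget) : vertex := inr (g, None).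
Definition inner (g : gadget) (s : 'S_a) : vertex := inr (g, Some (true, s)).
Definition outer (g : gadget) (s : 'S_a) : vertex := inr (g, Some (false, s)).

Definition frame (v : vertex) : 'S_a :=
  match v with inl s => s | inr (g, None) => g.1 | inr (_, Some (_, s)) => s end.

Definition level (o : option (bool * 'S_a)) : nat :=
  match o with None => 0 | Some (true, _) => 1 | Some (false, _) => 2 end.

(* The sums of levels allowed inside a gadget are 1 (root, inner), 3 (inner,
   outer) and 4 (outer, outer). *)
Definition linked (u v : vertex) : bool :=
  match u, v with
  | inl _, inl _ => true
  | inl _, inr (_, o) | inr (_, o), inl _ => level o == 2
  | inr (g, o), inr (g', o') => (g == g') && ((level o + level o' == 1)
      || (2 < level o + level o'))
  end.

Definition edge (u v : vertex) : bool :=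
  [disjoint col (frame u) & col (frame v)] && linked u v.

Lemma edge_sym u v : edge u v -> edge v u.
Proof.
rewrite /edge disjoint_sym => /andP[-> /=].
by case: u v => [u|[g o]] [v|[g' o']] //=; rewrite eq_sym (addnC (level o)).
Qed.

Lemma edge_irrefl v : ~~ edge v v.
Proof.
apply/negP=> /andP[+ _]; rewrite -setI_eq0 setIid => /eqP/(congr1 (fun A => #|pred_of_set A|)).
by rewrite card_col cards0; lia.
Qed.

(** It changes by at most one along an edge, is 0 at [root g] and 6 at every other root, and so
    certifies the distance. *)
Definition potential (g : gadget) (v : vertex) : nat :=
  match v with
  | inl _ => 3
  | inr (g', o) => if g' == g then level o else 6 - level o
  end.

Lemma potential_edge g u v : edge u v -> potential g v <= (potential g u).+1.
Proof.
case/andP=> _; case: u v => [u|[g1 o1]] [v|[g2 o2]] //=.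
- by case: ifP => _ /eqP->.
- by case: ifP => _ /eqP->.
- case/andP=> /eqP-> H; case: ifP => _; move: H; case: o1 o2 => [[[] s]|] [[[] s']|] //=.
Qed.

(** * Weights at one point: [chi] marks the vertices whose sets contain it, [C] the precolors that
    do *)

Section Pointwise.
Variables (chi : vertex -> bool) (C : {set 'I_p}).
Hypothesis chi_indep : forall u v, edge u v -> chi u -> chi v -> False.
Hypothesis chi_root : forall s i, i \in C -> chi (root (s, i)).

Let I := [set s | chi (core s)].

Definition gadget_weight (g : gadget) : nat :=
  \sum_(j < t) (b * chi (inner g (posA j g.1)))
  + \sum_(j < t) (d * chi (outer g (posB j g.1)))
  + \sum_(j < t) (d * chi (outer g (posB' j g.1)))
  + (b - d) * t * chi (outer g g.1).

Lemma edge_inner_outer g s s' :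
  [disjoint col s & col s'] -> edge (inner g s) (outer g s').
Proof. by move=> dis; rewrite /edge /= dis eqxx. Qed.

Lemma edge_outer_shift g s : edge (outer g s) (outer g (shift ^+ b * s)%g).
Proof. by rewrite /edge /= eqxx disjoint_col_shift // leqnn leq_addr. Qed.

Lemma edge_posB_posB' g j s : edge (outer g (posB j s)) (outer g (posB' j s)).
Proof. by rewrite posB'E edge_outer_shift. Qed.

Lemma outer_pair_le1 g j s : chi (outer g (posB j s)) + chi (outer g (posB' j s)) <= 1.
Proof.
have := chi_indep (edge_posB_posB' g j s).
by case: (chi _) => //; case: (chi _) => // /(_ isT isT).
Qed.

Lemma gadget_weight_le g : gadget_weight g <= b * t.
Proof.
rewrite /gadget_weight -!big_distrr /= !sum_bool_card.
set F := [set j : 'I_t | chi (inner g _)].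
set Q := [set j : 'I_t | chi (outer g (posB j _))].
set Q' := [set j : 'I_t | chi (outer g (posB' j _))].
have QQ' : [disjoint Q & Q'].
  apply/pred0P=> j /=; rewrite !inE; apply/negP=> /andP[].
  exact/chi_indep/edge_posB_posB'.
have cardQQ' : #|Q| + #|Q'| = #|Q :|: Q'|.
  by rewrite cardsU (disjoint_setI0 QQ') cards0 subn0.
(* If the vertex at [g.1] itself is selected, no arc [A_j] is, and each pair contributes at most
   [d]: at most [(b - d) * t + d * t] in all. *)
have [S|_] := boolP (chi (outer g g.1)).
  have -> : F = set0.
    apply/setP=> j; rewrite !inE; apply/negP=> /chi_indep/(_ S); apply.
    by apply: edge_inner_outer; rewrite disjoint_sym disjoint_posA.
  have := max_card (mem (Q :|: Q')); rewrite -cardQQ' card_ord cards0.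
  have [dl def_b] : {dl | b = d + dl} by exists (b - d); lia.
  have -> : b - d = dl by lia.
  move: #|Q| #|Q'| => x y le_xy.
  rewrite muln0 add0n muln1 -mulnDr [X in _ <= X * _]def_b mulnDl leq_add2r.
  by rewrite leq_mul2l le_xy orbT.
have := exits_isoperimetry_half (@ordS_inj t) F le_hd le_d2h.
rewrite card_ord muln0 addn0 -addnA -mulnDr cardQQ'; apply: leq_trans.
(* A selected [B_r] excludes the arcs [A_(r+k)] with [k <= d - h], and a selected [B'_r] those with
   [h <= k <= d]; so [r] or its [h]-th successor is outside the thickening of [F]. *)
rewrite addnC leq_add2r leq_mul2l; apply/orP; right; apply/subset_leq_card/subsetP=> r.
have posA_iter k : posA (iter k (@ordS t) r) g.1 = posA (r + k) g.1.
  by rewrite /posA iter_ordS turn_mod.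
rewrite !inE => /orP[] chi_r; apply/orP; [left|right]; apply/thickenP=> -[k le_k].
  rewrite inE posA_iter => /chi_indep/(_ chi_r); apply.
  exact/edge_inner_outer/disjoint_posA_posB.
rewrite -iterD inE posA_iter => /chi_indep/(_ chi_r); apply.
by apply/edge_inner_outer/disjoint_posA_posB'; lia.
Qed.

(** The root excludes all arcs [A_j]. The outer vertices are compared with the core through [X], and
    [exits_isoperimetry] on the permutations, applied for each [j], gives the bound after summation
    over [s]. *)
Lemma gadget_weight_root_le i : i \in C ->
  \sum_s gadget_weight (s, i) + b * t * #|I| <= b * t * #|{: 'S_a}|.
Proof.
move=> Ci; have mulI := @mulgI {perm 'I_a}.
set X := thicken (mulg shift) I d.
have XN g s : chi (outer g s) -> iter b (mulg shift) s \notin X.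
  move=> chi_s; apply/thickenP=> -[k le_k]; rewrite -iterD inE iter_mulg_shift.
  by apply: (chi_indep _ chi_s); rewrite /edge /= disjoint_col_shift //; lia.
have := exits_isoperimetry (mulI shift) I (b - d) d; rewrite subnK // -/X => iso.
have innerF s j : chi (inner (s, i) (posA j s)) = false.
  apply/negP; apply: (chi_indep _ (chi_root s Ci)).
  by rewrite /edge /= eqxx disjoint_posA.
have outer_s : \sum_s (chi (outer (s, i) s) : nat) <= #|~: X|.
  apply: (sum_bool_le_inj (iter_inj (mulI shift) (h := b))) => s /XN; by rewrite inE.
have outer_j j :
  \sum_s (chi (outer (s, i) (posB j s)) + chi (outer (s, i) (posB' j s)) : nat)
    <= #|exits (mulg shift) b X|.
  (* At most one member of a pair is selected, so the sum is a disjunction, and [posB j] followed by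
     [b] shifts injects it into the exits. *)
  rewrite (eq_bigr (fun s => chi (outer (s, i) (posB j s)) || chi (outer (s, i) (posB' j s)) : nat)).
    apply: (sum_bool_le_inj (g := fun s => iter b (mulg shift) (posB j s))).
      by move=> s s' /(iter_inj (mulI shift)) /mulI/mulI.
    move=> s /orP[] /XN; first by rewrite inE => ->.
    by rewrite posB'E -iter_mulg_shift inE => ->; rewrite orbT.
  by move=> s _; have := outer_pair_le1 (s, i) j s; case: (chi _); case: (chi _).
have weightE s : gadget_weight (s, i) =
    d * \sum_(j < t) (chi (outer (s, i) (posB j s)) + chi (outer (s, i) (posB' j s)))
    + (b - d) * t * chi (outer (s, i) s).
  rewrite /gadget_weight -!big_distrr /= (eq_bigr (fun=> 0)) => [|j _]; last by rewrite innerF.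
  by rewrite sum_nat_const muln0 muln0 add0n -mulnDr -big_split.
rewrite (eq_bigr _ (fun s _ => weightE s)) big_split -!big_distrr /= exchange_big /=.
set sB := (X in d * X); have : sB <= t * #|exits (mulg shift) b X|.
  rewrite -[X in X * _]card_ord -sum_nat_const; apply: leq_sum => j _; exact: outer_j.
move: outer_s iso; move: (\sum_s _) sB #|~: X| #|exits _ _ X| #|I| #|{: 'S_a}|.
move: (b - d) => dl sS sB m e c n le_S iso le_B.
have : t * (dl * m + d * e + b * c) <= t * (b * n) by rewrite leq_mul2l iso orbT.
have : dl * t * sS <= dl * t * m by rewrite leq_mul2l le_S orbT.
have : d * sB <= d * (t * e) by rewrite leq_mul2l le_B orbT.
by move: t => t'; nia.
Qed.

(** Each precolor in [C] saves [b * t * #|I|]; the others obey the plain gadget bound. *)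
Lemma total_weight_le q : q <= #|C| ->
  \sum_g gadget_weight g + q * (b * t) * #|I| <= p * (b * t) * #|{: 'S_a}|.
Proof.
move=> le_qC; rewrite (eq_bigr (fun g => gadget_weight (g.1, g.2))) => [|[]] //.
rewrite -(pair_bigA _ (fun s i => gadget_weight (s, i))) /= exchange_big /=.
have sumC : q * (b * t) * #|I| <= \sum_(i < p) (i \in C) * (b * t * #|I|).
  rewrite -big_distrl /= sum_bool_card -mulnA leq_mul2r (leq_trans le_qC) ?orbT //.
  by rewrite subset_leq_card //; apply/subsetP=> i; rewrite inE.
rewrite (leq_trans (leq_add (leqnn _) sumC)) // -big_split /=.
have -> : p * (b * t) * #|{: 'S_a}| = \sum_(i < p) b * t * #|{: 'S_a}|.
  by rewrite sum_nat_const card_ord !mulnA.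
apply: leq_sum => i _; case: (boolP (i \in C)) => [Ci|_].
  by rewrite mul1n; apply: gadget_weight_root_le.
by rewrite addn0 (mulnC (b * t)) -sum_nat_const; apply: leq_sum => s _; apply: gadget_weight_le.
Qed.

End Pointwise.

(** * The weighted family of vertices *)

Definition weighted : finType := (gadget * ('I_t + 'I_t + 'I_t + unit) + 'S_a)%type.

(** The weight of a core vertex turns the saving in [total_weight_le] into part of a single weighted
    sum. *)
Definition weight (q : nat) (x : weighted) : nat :=
  match x with
  | inl (_, inl (inl (inl _))) => b
  | inl (_, inl _) => d
  | inl (_, inr _) => (b - d) * t
  | inr _ => q * (b * t)
  end.

Definition position (x : weighted) : vertex :=
  match x with
  | inl (g, inl (inl (inl j))) => inner g (posA j g.1)
  | inl (g, inl (inl (inr j))) => outer g (posB j g.1)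
  | inl (g, inl (inr j)) => outer g (posB' j g.1)
  | inl (g, inr _) => outer g g.1
  | inr s => core s
  end.

Lemma weight_sumE q (chi : vertex -> bool) :
  \sum_x weight q x * chi (position x) =
  \sum_g gadget_weight chi g + q * (b * t) * #|[set s | chi (core s)]|.
Proof.
rewrite big_sumType /= -big_distrr /= sum_bool_card; congr (_ + _).
rewrite (eq_bigr (fun x => weight q (inl (x.1, x.2)) * chi (position (inl (x.1, x.2)))));
  last by case.
rewrite -(pair_bigA _ (fun g j => weight q (inl (g, j)) * chi (position (inl (g, j))))) /=.
apply: eq_bigr => g _; rewrite !big_sumType /= /gadget_weight; congr (_ + _).
by rewrite big_const card_unit /= addn0.
Qed.

(** One gadget weighs [b * t + 2 * d * t + (b - d) * t = a * t], and there are [p] gadgets for each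
    permutation. *)
Lemma weight_sum q :
  \sum_x weight q x = #|{: 'S_a}| * t * (p * a + q * b).
Proof.
have := weight_sumE q (fun=> true); rewrite (eq_bigr (weight q)) => [->|x _]; last by rewrite muln1.
rewrite /gadget_weight !sum_nat_const !card_ord !muln1 card_prod card_ord.
have -> : [set s : 'S_a | true] = setT by apply/setP=> s; rewrite !inE.
rewrite cardsT; have : b - d + d = b by rewrite subnK.
move: #|_| (b - d) => n dl; move: (2 * h) => b' <-; nia.
Qed.

(** The powers of [shift] give the [a] cyclic arcs of length [b], of which a color can be on at most
    [b]; this yields the lower bound [a / b] on the chromatic number. *)
Lemma core_card_le (chi : vertex -> bool) :
  (forall u v, edge u v -> chi u -> chi v -> False) ->
  #|[set i : 'I_a | chi (core (shift ^+ i)%g)]| <= b.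
Proof.
move=> chi_indep; apply: (independent_card (@ordS_inj a) iter_ordS_full (d := d)).
  by rewrite card_ord.
move=> i j; rewrite !inE => chi_i int_j; apply/negP; apply: chi_indep chi_i.
have -> : (shift ^+ iter j (@ordS a) i = shift ^+ j * shift ^+ i)%g.
  rewrite iter_ordS (addnC i) -expgnDr; apply/permP=> k; apply/val_inj.
  by rewrite /= !shiftE modnDmr.
by rewrite /edge /= disjoint_col_shift.
Qed.

End Gadget.

(** * Graphs on a finite type, coded by natural numbers *)

Section FiniteTypeGraph.
Variables (V : finType) (e : V -> V -> bool).
Hypotheses (e_sym : forall u v, e u v -> e v u) (e_irrefl : forall v, ~~ e v v).

Definition code (v : V) : nat := enum_rank v.

Lemma code_inj : injective code.
Proof. by move=> u v /val_inj/enum_rank_inj. Qed.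

Definition code_adj (m n : nat) : Prop := exists u v, [/\ m = code u, n = code v & e u v].

Lemma code_adj_sym m n : code_adj m n -> code_adj n m.
Proof. by case=> u [v [-> -> /e_sym uv]]; exists v, u. Qed.

Lemma code_adj_irrefl n : ~ code_adj n n.
Proof. by case=> u [v [-> /code_inj-> uv]]; move/negP: (e_irrefl v). Qed.

Lemma code_adj_range m n : code_adj m n -> (m < #|V|)%coq_nat /\ (n < #|V|)%coq_nat.
Proof. by case=> u [v [-> -> _]]; split; apply/ltP/ltn_ord. Qed.

Definition code_graph : graph :=
  @Graph #|V| code_adj code_adj_sym code_adj_irrefl code_adj_range.

Definition on_code (S : V -> R -> Prop) (n : nat) (x : R) : Prop :=
  exists2 v, n = code v & S v x.

Lemma on_codeE (S : V -> R -> Prop) v x : on_code S (code v) x <-> S v x.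
Proof. by split=> [[u /code_inj<-]|] //; exists v. Qed.

Lemma unit_subset_ext m (S S' : R -> Prop) :
  (forall x, S x <-> S' x) -> unit_subset m S -> unit_subset m S'.
Proof.
move=> eqS [bS [mS oS]]; split; first by move=> x /eqS/bS.
by split; [apply: measurable_ext mS | apply: outer_ext oS].
Qed.

Lemma on_code_unit_subset m (S : V -> R -> Prop) v :
  unit_subset m (S v) -> unit_subset m (on_code S (code v)).
Proof. by apply: unit_subset_ext => x; apply: iff_sym; apply: on_codeE. Qed.

Lemma code_graph_coloring m (S : V -> R -> Prop) :
  (forall v, unit_subset m (S v)) ->
  (forall u v x, e u v -> S u x -> S v x -> False) ->
  frac_coloring code_graph m (on_code S).
Proof.
move=> unitS indepS; split=> [n /ltP ltn|m' n [u [v [-> -> uv]]] x []].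
  by rewrite -[n]/(val (Ordinal ltn)) -(enum_valK (Ordinal ltn)); apply: on_code_unit_subset.
by move=> /on_codeE Su /on_codeE Sv; apply: indepS uv Su Sv.
Qed.

Lemma code_walk_potential (f : V -> nat) :
  (forall u v, e u v -> f v <= (f u).+1) ->
  forall m n l, walk code_graph m n l ->
  forall u v, m = code u -> n = code v -> f v <= f u + l.
Proof.
move=> f_edge m n l; elim=> [n' u v -> /code_inj->|m' k n' l' [u1 [w [-> -> u1w]]] _ IH].
  by rewrite addn0.
move=> u v /code_inj<- /(IH _ _ erefl) le_v; rewrite (leq_trans le_v) // addnS -addSn leq_add2r.
exact: f_edge.
Qed.

Section Coloring.
Variables (m : R) (c : nat -> R -> Prop).
Hypothesis c_coloring : frac_coloring code_graph m c.

Lemma code_unit_subset v : unit_subset m (c (code v)).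
Proof. by case: c_coloring => + _; apply; apply/ltP/ltn_ord. Qed.

(** Reduces a bound on a fractional coloring to independent sets: [chi] is the set of vertices whose
    color sets contain a given point. *)
Lemma code_weight_le (J : finType) (w : J -> nat) (v : J -> V) (K : nat) :
  (0 <= m)%R ->
  (forall x (chi : V -> bool), (0 <= x < m)%R ->
     (forall u, chi u <-> c (code u) x) ->
     (forall u u', e u u' -> chi u -> chi u' -> False) ->
     \sum_j w j * chi (v j) <= K) ->
  (INR (\sum_j w j) <= INR K * m)%R.
Proof.
move=> m_ge0 bound.
have lsumE (f : J -> nat) : lsum f (enum J) = \sum_j f j.
  rewrite -big_enum; elim: (enum J) => [|j s IH]; first by rewrite big_nil.
  by rewrite big_cons /= IH.
rewrite -lsumE.
apply: (@unit_sets_weight_le J w (fun j => c (code (v j)))) => // [j|x x_in].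
  exact: code_unit_subset.
pose chi u : bool := if excluded_middle_informative (c (code u) x) then true else false.
have chiE u : chi u <-> c (code u) x by rewrite /chi; case: excluded_middle_informative.
apply/leP; rewrite lsumE.
have := bound x chi x_in chiE; rewrite (eq_bigr (fun j => w j * indic (c (code (v j)) x))).
  apply=> u u' uu' /chiE cu /chiE cu'; case: c_coloring => _ /(_ (code u) (code u')).
  by move/(_ (ex_intro _ u (ex_intro _ u' (And3 erefl erefl uu'))) x); apply.
by move=> j _; rewrite /chi /indic; case: excluded_middle_informative.
Qed.

End Coloring.

End FiniteTypeGraph.

(** * Chromatic number, distances and the precoloring *)

Section Construction.
Variables (h d p : nat).
Hypotheses (h_gt0 : 0 < h) (le_hd : h <= d) (le_d2h : d <= 2 * h).
Local Notation b := (2 * h).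
Local Notation a := (2 * b + d).
Local Notation t := (b + d).
Local Notation V := (vertex h d p).

Definition tree_graph : graph :=
  code_graph (@edge_sym h d p) (edge_irrefl h_gt0 le_hd le_d2h).

(** Each vertex receives the cells of the colors in [col] of its frame; adjacent vertices have
    disjoint ones. *)
Lemma tree_graph_colorable : frac_colorable tree_graph (INR a / INR b).
Proof.
pose l (v : V) := [seq val i | i <- enum (col (frame v))].
have InE (s : seq nat) i : List.In i s <-> i \in s.
  elim: s => [|j s IH] //=; rewrite inE; split.
    by case=> [->|/IH->]; rewrite ?eqxx ?orbT.
  by case/orP=> [/eqP->|/IH]; [left|right].
have NoDupP (s : seq nat) : uniq s -> List.NoDup s.
  elim: s => [_|j s IH /= /andP[js us]]; first exact: List.NoDup_nil.
  by apply: List.NoDup_cons; [move/InE; apply/negP | apply: IH].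
exists (on_code (fun v => atoms (/ INR b) (l v))); apply: code_graph_coloring => [v|u v x].
  apply: atoms_unit_subset; first by apply/ltP; lia.
  - by apply/NoDupP; rewrite map_inj_uniq ?enum_uniq //; apply: val_inj.
  - by change (size (l v) = b); rewrite size_map -cardE card_col.
  - by move=> i /InE/mapP[j _ ->]; apply/ltP/ltn_ord.
case/andP=> /pred0P dis _ Hu Hv.
apply: (@atoms_disjoint (/ INR b) (l u) (l v) _ _ x) => //.
  by apply/Rinv_0_lt_compat/lt_0_INR/ltP; lia.
move=> i /InE/mapP[j + ->] /InE/mapP[j' + /val_inj eq_j].
by rewrite !mem_enum -eq_j => ju jv; have := dis j; rewrite /= ju jv.
Qed.

Lemma tree_graph_chromatic : frac_chromatic_number tree_graph (INR a / INR b).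
Proof.
have b_gt0 : (0 < INR b)%R by apply/lt_0_INR/ltP; lia.
split=> [m [m_gt0 [c c_col]]|m]; last first.
  apply; split; last exact: tree_graph_colorable.
  by apply: Rdiv_lt_0_compat => //; apply/lt_0_INR/ltP; lia.
have : (INR (\sum_(i < a) 1) <= INR b * m)%R.
  apply: (code_weight_le c_col (w := fun=> 1) (v := fun i : 'I_a => core p (shift h d ^+ i)%g)); first lra.
  move=> x chi _ _ chi_indep; rewrite (eq_bigr (fun i : 'I_a => chi (core p (shift h d ^+ i)%g) : nat)).
    by rewrite sum_bool_card; apply: core_card_le.
  by move=> i _; rewrite mul1n.
rewrite sum_nat_const card_ord muln1 => le_am.
apply: (Rmult_le_reg_r (INR b)) => //; rewrite /Rdiv Rmult_assoc Rinv_l; lra.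
Qed.

Definition roots (n : nat) : Prop := exists g : 'S_a * 'I_p, n = code (root g).

(** Only the values at roots matter; core vertices get the empty set by default. *)
Definition windows (m : R) : nat -> R -> Prop :=
  on_code (fun v : V => match v with
    | inl _ => fun=> False
    | inr (g, _) => window m (INR g.2 * (m / INR p)) end).

Lemma roots_range n : roots n -> (n < nverts tree_graph)%coq_nat.
Proof. by case=> g ->; apply/ltP/ltn_ord. Qed.

Lemma roots_dist u v : roots u -> roots v -> u <> v -> dist_ge tree_graph u v 6.
Proof.
move=> [g ->] [g' ->] neq_g l.
move/(code_walk_potential (@potential_edge h d p g))/(_ _ _ erefl erefl) => /=.
by rewrite eqxx; case: eqP neq_g => [-> []|_ _ /leP].
Qed.

Lemma windows_unit_subset m n :
  (1 <= m)%R -> roots n -> unit_subset m (windows m n).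
Proof.
move=> m_ge1 [[s i] ->]; apply: on_code_unit_subset; apply: window_unit_subset => //=.
have p_gt0 : (0 < INR p)%R by apply/lt_0_INR/ltP; case: p i => [[]|].
have lt_ip : (INR i < INR p)%R by apply/lt_INR/ltP/ltn_ord.
have i_ge0 := pos_INR i.
split; first by apply: Rmult_le_pos => //; apply/Rlt_le/Rdiv_lt_0_compat; lra.
apply: (Rmult_lt_reg_r (INR p)) => //.
by rewrite /Rdiv -!Rmult_assoc Rmult_assoc Rinv_l; nra.
Qed.

Lemma windows_not_extendable m q :
  (1 <= m)%R -> 0 < p -> q <= p -> (INR q * m <= INR p)%R ->
  (INR p * INR b * m < INR p * INR a + INR q * INR b)%R ->
  ~ precoloring_extends tree_graph roots m (windows m).
Proof.
move=> m_ge1 p_gt0 le_qp le_qmp lt_m [c [c_col c_roots]].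
have : (INR (\sum_(x : weighted h d p) weight q x) <= INR (p * (b * t) * #|{: 'S_a}|) * m)%R.
  apply: (code_weight_le c_col (v := position h_gt0 le_hd le_d2h (p := p))); first lra.
  move=> x chi x_in chiE chi_indep; rewrite weight_sumE.
  (* A window depends only on the index [i], so the roots with index [i] contain [x] all together;
     [window_covered] gives [q] such indices. *)
  pose C := [set i : 'I_p | [forall s, chi (root (s, i))]].
  apply: (total_weight_le h_gt0 le_hd le_d2h (C := C)) => //.
    by move=> s i; rewrite inE => /forallP.
  have m_gt0 : (0 < m)%R by lra.
  have [f [f_inj f_win]] := window_covered m x p q m_gt0 (elimT ltP p_gt0) le_qmp (elimT leP le_qp) x_in.
  have lt_f (j : 'I_q) : f j < p by apply/ltP; case: (f_win j (elimT ltP (ltn_ord j))).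
  pose F (j : 'I_q) : 'I_p := Ordinal (lt_f j).
  have F_inj : injective F.
    by move=> j j' [eq_f]; apply/val_inj/f_inj => //; apply/ltP/ltn_ord.
  rewrite -[q]card_ord -cardsT -(card_imset _ F_inj); apply/subset_leq_card/subsetP.
  move=> _ /imsetP[j _ ->]; rewrite inE; apply/forallP=> s; apply/chiE.
  apply/c_roots; first by exists (s, F j).
  by apply/on_codeE; case: (f_win j (elimT ltP (ltn_ord j))).
have INRM x y : INR (x * y) = (INR x * INR y)%R by exact: mult_INR.
have INRD x y : INR (x + y) = (INR x + INR y)%R by exact: plus_INR.
rewrite weight_sum // !(INRM, INRD).
have n_gt0 : (0 < INR #|{: 'S_a}|)%R.
  by apply/lt_0_INR/ltP/card_gt0P; exists 1%g.
have t_gt0 : (0 < INR 2 * INR h + INR d)%R.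
  by rewrite -INRM -INRD; apply/lt_0_INR/ltP; lia.
have := Rmult_lt_0_compat _ _ n_gt0 t_gt0.
move: lt_m; rewrite !(INRM, INRD).
set n := INR #|_|; set t' := (_ + INR d)%R; set b' := (INR 2 * INR h)%R.
move=> lt_m nt_gt0 le_m.
have := Rmult_lt_compat_l _ _ _ nt_gt0 lt_m; lra.
Qed.

End Construction.

(** With [b = 2 h] and [a = 4 h + d], the strict inequality says [m - a / b < q / p]. *)
Lemma nonextendable_precoloring (h d p q : nat) (m : R) :
  (0 < h)%coq_nat -> (h <= d)%coq_nat -> (d <= Nat.mul 2 h)%coq_nat ->
  (0 < p)%coq_nat -> (q <= p)%coq_nat -> (1 <= m)%R -> (INR q * m <= INR p)%R ->
  (INR p * INR (Nat.mul 2 h) * m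
     < INR p * INR (Nat.add (Nat.mul 4 h) d) + INR q * INR (Nat.mul 2 h))%R ->
  exists (G : graph) (W : nat -> Prop) (pre : nat -> R -> Prop),
    frac_chromatic_number G (INR (Nat.add (Nat.mul 4 h) d) / INR (Nat.mul 2 h))%R /\
    (forall v, W v -> (v < nverts G)%coq_nat) /\
    (forall u v, W u -> W v -> u <> v -> dist_ge G u v 6) /\
    frac_precoloring G W m pre /\
    ~ precoloring_extends G W m pre.
Proof.
move=> /ltP h_gt0 /leP le_hd /leP le_d2h /ltP p_gt0 /leP le_qp m_ge1 le_qm.
have -> : Nat.add (Nat.mul 4 h) d = 2 * (2 * h) + d by lia.
move=> lt_m; exists (tree_graph p h_gt0 le_hd le_d2h), (roots h d p), (windows h d p m).
split; first exact: tree_graph_chromatic.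
split; first exact: roots_range.
split; first exact: roots_dist.
split; first by move=> v; apply: windows_unit_subset.
exact: windows_not_extendable lt_m.
Qed.

End GraphConstruction.

(** * Choice of parameters for a rational [k] *)

Theorem mainTheorem14 (k eps : R) :
  is_rational k -> 5 / 2 <= k < 3 ->
  0 < eps -> eps < 1 / (k + eps) ->
  exists (G : graph) (W : nat -> Prop) (p : nat -> R -> Prop),
    frac_chromatic_number G k /\
    (forall v, W v -> (v < nverts G)%nat) /\
    (forall u v, W u -> W v -> u <> v -> dist_ge G u v 6) /\
    frac_precoloring G W (k + eps) p /\
    ~ precoloring_extends G W (k + eps) p.
Proof.
  intros (z & w & Hw & Hk) [Hk1 Hk2] He1 He2.
  destruct (exists_ratio eps (k + eps)) as (p & q & Hp & Hqp & Hqm & Hq); try lra.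
  (* Absolute values allow a negative denominator. Doubling the fraction makes [b = 2 h] even, with
     [a = 2 z'] and [d = 2 z' - 4 h]. *)
  set (h := Z.to_nat (Z.abs w)). set (z' := Z.to_nat (Z.abs z)).
  assert (HhR : INR h = Rabs (IZR w)).
  { unfold h. rewrite INR_IZR_INZ, Z2Nat.id, abs_IZR by lia. reflexivity. }
  assert (HzR : INR z' = Rabs (IZR z)).
  { unfold z'. rewrite INR_IZR_INZ, Z2Nat.id, abs_IZR by lia. reflexivity. }
  assert (Hh : (0 < h)%nat) by (unfold h; lia).
  assert (HhR0 := lt_0_INR h Hh).
  assert (Hkz : k * INR h = INR z').
  { rewrite <- (Rabs_pos_eq k), HhR, HzR, <- Rabs_mult by lra.
    f_equal. rewrite Hk. field. apply IZR_neq, Hw. }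
  (* These two bounds on [k] become [h <= d] and [d <= 2 h]. *)
  assert (H1 : (5 * h <= 2 * z')%nat).
  { apply INR_le. rewrite !mult_INR, <- Hkz. simpl INR. nra. }
  assert (H2 : (z' <= 3 * h)%nat).
  { apply INR_le. rewrite !mult_INR, <- Hkz. simpl INR. nra. }
  assert (Ha : INR (4 * h + (2 * z' - 4 * h)) = k * INR (2 * h)).
  { replace (4 * h + (2 * z' - 4 * h))%nat with (2 * z')%nat by lia.
    rewrite !mult_INR, <- Hkz. ring. }
  assert (Hb : 0 < INR (2 * h)) by (apply lt_0_INR; lia).
  assert (Hkd : INR (4 * h + (2 * z' - 4 * h)) / INR (2 * h) = k)
    by (rewrite Ha; field; lra).
  assert (H := @nonextendable_precoloring h (2 * z' - 4 * h) p q (k + eps)).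
  rewrite Hkd, Ha in H. apply H; try lia; try lra. nra.
Qed.
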